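(* Assume either the Continuum Hypothesis or Ostaszewski's $\clubsuit$-principle. Then there is an AD family $\mathcal{A}$ over a countable set which is $\omega$-inseparable and which codes every $\omega_1$-like partial order.
   Context: For sets $A,B$: $A\subseteq^* B$ means $A\setminus B$ is finite, and $A=^*B$ means $A\subseteq^*B$ and $B\subseteq^*A$. An AD family over a countable set $N$ is a family of infinite subsets of $N$ with pairwise finite intersections. For $n\geq 2$, a tuple $(\mathcal{L}_i:i<n)$ of families of subsets of $N$ is a pregap if $L\cap L'$ is finite whenever $L\in\mathcal{L}_i$, $L'\in\mathcal{L}_j$, $i\neq j$; a function $c:n\to\mathscr{P}(N)$ separates it if $L\subseteq^* c(i)$ for all $i<n$, $L\in\mathcal{L}_i$, and $\bigcap_{i<n}c(i)$ is finite; it is an $n$-gap if it is a pregap and no such $c$ exists. An AD family $\mathcal{A}$ is $n$-inseparable if for any pairwise disjoint uncountable $\mathcal{L}_0,\dots,\mathcal{L}_{n-1}\subseteq\mathcal{A}$ the tuple $(\mathcal{L}_i:i<n)$ is an $n$-gap; it is $\omega$-inseparable if it is $n$-inseparable for every $n\geq2$. $\clubsuit$: there is a sequence $\langle C_\delta:\delta\in\mathrm{Lim}\rangle$, $\mathrm{Lim}$ the set of nonzero countable limit ordinals, with $C_\delta\subseteq\delta$ of order type $\omega$ and $\sup C_\delta=\delta$, such that for every uncountable $S\subseteq\omega_1$ the set $\{\delta\in\mathrm{Lim}:C_\delta\subseteq S\}$ is stationary. A partial order $(X,\leq)$ is $\omega_1$-like if it is well-founded, $|X|=\omega_1$, and $(-\infty,x)=\{y:y<x\}$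 is countable for every $x$. $\inf(x,y)$ is the greatest lower bound when it exists; $x,y$ are incompatible if no $z$ satisfies $z\leq x,z\leq y$. $\mathrm{pred}(x)$ is the set of maximal elements of $(-\infty,x)$; $x$ is successor-like if $\mathrm{pred}(x)$ is finite and every $y<x$ is $\leq$ some $z\in\mathrm{pred}(x)$. An almost disjoint representation of $X$ is a pair $\langle T_x\rangle_{x\in X}$, $\langle A_x\rangle_{x\in X}$ of indexed families of infinite subsets of a countable set, $x\mapsto A_x$ injective and $\{A_x\}$ AD, such that for all $x,y$: (a) $A_x\subseteq T_x$; (b) $y\not\leq x\Rightarrow A_y\subseteq^*T_y\setminus T_x$; (c) if $\inf(x,y)$ exists, $T_x\cap T_y=^*T_{\inf(x,y)}$; (d) $x$ successor-like $\Rightarrow T_x\setminus\bigcup_{z\in\mathrm{pred}(x)}T_z=^*A_x$; (e) $x,y$ incompatible $\Rightarrow T_x\cap T_y=^*\emptyset$. An AD family $\mathcal{A}$ of size $\omega_1$ codes $X$ if there are a bijective indexing $\mathcal{A}=\{A_x:x\in X\}$ and sets $T_x$ making this an almost disjoint representation of $X$. *)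

(* Defs.v *)
From Stdlib Require Import Arith List.
Set Implicit Arguments.
Unset Strict Implicit.

Definition countable (T : Type) : Prop :=
  exists f : T -> nat, forall a b, f a = f b -> a = b.

Definition bijective_map (A B : Type) (f : A -> B) : Prop :=
  (forall a b, f a = f b -> a = b) /\ (forall y, exists x, f x = y).

Definition is_omega1 (W : Type) (lt : W -> W -> Prop) : Prop :=
  well_founded lt /\
  (forall a b c, lt a b -> lt b c -> lt a c) /\
  (forall a b, lt a b \/ a = b \/ lt b a) /\
  ~ countable W /\
  (forall a, countable {b : W | lt b a}).

Definition card_omega1 (W : Type) (T : Type) : Prop :=
  exists f : W -> T, bijective_map f.

Definition CH (W : Type) : Prop := card_omega1 W (nat -> bool).

Definition is_limit W (lt : W -> W -> Prop) (d : W) : Prop :=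
  (exists a, lt a d) /\ (forall a, lt a d -> exists b, lt a b /\ lt b d).

Definition club W (lt : W -> W -> Prop) (D : W -> Prop) : Prop :=
  (forall a, exists b, D b /\ lt a b) /\
  (forall d, is_limit lt d ->
     (forall a, lt a d -> exists b, D b /\ lt a b /\ lt b d) -> D d).

Definition stationary W (lt : W -> W -> Prop) (S : W -> Prop) : Prop :=
  forall D, club lt D -> exists d, S d /\ D d.

Definition ladder W (lt : W -> W -> Prop) (d : W) (C : W -> Prop) : Prop :=
  (exists c : nat -> W, (forall n, lt (c n) (c (S n))) /\
                        (forall w, C w <-> exists n, c n = w)) /\
  (forall w, C w -> lt w d) /\
  (forall a, lt a d -> exists w, C w /\ lt a w).

Definition clubsuit W (lt : W -> W -> Prop) : Prop :=
  exists C : W -> (W -> Prop),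
    (forall d, is_limit lt d -> ladder lt d (C d)) /\
    (forall S : W -> Prop, ~ countable {w : W | S w} ->
       stationary lt (fun d => is_limit lt d /\ forall w, C d w -> S w)).

Definition nset := nat -> Prop.
Definition finite_nat (S : nset) : Prop := exists m, forall k, S k -> k < m.
Definition sub_star (A B : nset) : Prop := finite_nat (fun k => A k /\ ~ B k).
Definition eq_star (A B : nset) : Prop := sub_star A B /\ sub_star B A.
Definition inter (A B : nset) : nset := fun k => A k /\ B k.
Definition diff (A B : nset) : nset := fun k => A k /\ ~ B k.

Definition family := nset -> Prop.

Definition AD_family (F : family) : Prop :=
  (forall A, F A -> ~ finite_nat A) /\
  (forall A B, F A -> F B -> A <> B -> finite_nat (inter A B)).

Definition pregap (n : nat) (L : nat -> family) : Prop :=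
  forall i j, i < n -> j < n -> i <> j ->
    forall X Y, L i X -> L j Y -> finite_nat (inter X Y).

Definition separates (n : nat) (L : nat -> family) (c : nat -> nset) : Prop :=
  (forall i, i < n -> forall X, L i X -> sub_star X (c i)) /\
  finite_nat (fun k => forall i, i < n -> c i k).

Definition n_gap (n : nat) (L : nat -> family) : Prop :=
  pregap n L /\ ~ exists c, separates n L c.

Definition n_inseparable (n : nat) (F : family) : Prop :=
  forall L : nat -> family,
    (forall i, i < n -> forall X, L i X -> F X) ->
    (forall i, i < n -> ~ countable {X : nset | L i X}) ->
    (forall i j, i < n -> j < n -> i <> j -> forall X, L i X -> L j X -> False) ->
    n_gap n L.

Definition omega_inseparable (F : family) : Prop :=
  forall n, 2 <= n -> n_inseparable n F.

Section PO.
Variables (X : Type) (le : X -> X -> Prop).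

Definition ltX (x y : X) : Prop := le x y /\ x <> y.

Definition omega1_like (W : Type) : Prop :=
  (forall x, le x x) /\
  (forall x y, le x y -> le y x -> x = y) /\
  (forall x y z, le x y -> le y z -> le x z) /\
  well_founded ltX /\
  card_omega1 W X /\
  (forall x, countable {y : X | ltX y x}).

Definition is_inf (x y z : X) : Prop :=
  le z x /\ le z y /\ forall w, le w x -> le w y -> le w z.

Definition incompatible (x y : X) : Prop := ~ exists z, le z x /\ le z y.

Definition in_pred (y x : X) : Prop :=
  ltX y x /\ ~ exists z, ltX y z /\ ltX z x.

Definition successor_like (x : X) : Prop :=
  (exists l : list X, forall y, in_pred y x <-> In y l) /\
  (forall y, ltX y x -> exists z, in_pred z x /\ le y z).

Definition AD_representation (T A : X -> nset) : Prop :=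
  (forall x y, A x = A y -> x = y) /\
  AD_family (fun S => exists x, S = A x) /\
  (forall x k, A x k -> T x k) /\
  (forall x y, ~ le y x -> sub_star (A y) (diff (T y) (T x))) /\
  (forall x y z, is_inf x y z -> eq_star (inter (T x) (T y)) (T z)) /\
  (forall x, successor_like x ->
     eq_star (fun k => T x k /\ ~ exists z, in_pred z x /\ T z k) (A x)) /\
  (forall x y, incompatible x y -> eq_star (inter (T x) (T y)) (fun _ => False)).

Definition codes (F : family) : Prop :=
  exists A : X -> nset,
    (forall S, F S <-> exists x, S = A x) /\
    (forall x y, A x = A y -> x = y) /\
    exists T : X -> nset, AD_representation T A.
End PO.

(* Main.v *)
(** Build partial functions [h a : omega -> {x | x <= a}] for [a < omega_1] that cohere:
    for [a < b], [h a] and the part of [h b] with values [<= a] differ at finitely many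
    points.  Put [A_a = (h a)^-1(a)], so [(h b)^-1(a) =* A_a] whenever [a <= b].

    Coding needs nothing else.  Index [X] by [omega_1] through any bijection [w], choose
    [b] above [w y] for all [y <= x], and let [T_x] be the set where [h b] takes a value
    [w y] with [y <= x].  By coherence, finitely many of the sets [T_x], [A_x] can be
    computed, modulo finite, from one function, where all clauses are immediate.

    For inseparability, fix sets [U_d], [d < omega_1], and at stage [a] make [A_a] meet in
    an infinite set every finite intersection [D] of the [U_d], [d <= a], that is not
    almost covered by the domain of an earlier function, while keeping [D] uncovered.
    Under CH the [U_d] are all subsets of [omega]; under club, [U_d] is the union of the
    [A_x] with [x] in the ladder [C_d].  If [A_x] is almost contained in [c(i)] for
    uncountably many [x], for each [i < n], then by induction on [j <= n] some such [D]
    stays uncovered and is almost contained in [c(0)], ..., [c(j-1)]: uncountably many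
    [A_x] meet [D] in an infinite set and are almost contained in [c(j)], so a suitable
    [U_d] almost contained in [c(j)] can be added to the intersection.  For [j = n] this
    makes the intersection of all [c(i)] infinite. *)

From Stdlib Require Import Arith List Lia Cantor.
From Stdlib Require Import Classical ClassicalEpsilon FunctionalExtensionality
  PropExtensionality ProofIrrelevance.
Require Import Defs.
Set Implicit Arguments.
Unset Strict Implicit.

(** * Cofinite and infinite sets of natural numbers *)

Definition eventually (P : nat -> Prop) : Prop := exists m, forall k, m <= k -> P k.

Lemma eventually_all (P : nat -> Prop) : (forall k, P k) -> eventually P.
Proof. intros H. exists 0. auto. Qed.

Lemma eventually_mono (P Q : nat -> Prop) :
  (forall k, P k -> Q k) -> eventually P -> eventually Q.
Proof. intros H [m Hm]. exists m. auto. Qed.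

Lemma eventually_and (P Q : nat -> Prop) :
  eventually P -> eventually Q -> eventually (fun k => P k /\ Q k).
Proof.
  intros [m Hm] [m' Hm']. exists (max m m'). intros k Hk.
  split; [apply Hm | apply Hm']; lia.
Qed.

Lemma eventually_Forall (T : Type) (P : T -> nat -> Prop) (l : list T) :
  Forall (fun t => eventually (P t)) l -> eventually (fun k => Forall (fun t => P t k) l).
Proof.
  induction 1 as [|t l Ht _ IH].
  - now apply eventually_all.
  - apply (eventually_mono (P := fun k => P t k /\ Forall (fun t => P t k) l)).
    + intros k []. now constructor.
    + now apply eventually_and.
Qed.

Lemma eventually_forall_le (P : nat -> nat -> Prop) (n : nat) :
  (forall i, i <= n -> eventually (P i)) -> eventually (fun k => forall i, i <= n -> P i k).
Proof.
  intros H. apply (eventually_mono (P := fun k => Forall (fun i => P i k) (seq 0 (S n)))).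
  - intros k Hk i Hi. apply (proj1 (Forall_forall _ _) Hk), in_seq. lia.
  - apply eventually_Forall, Forall_forall. intros i Hi%in_seq. apply H. lia.
Qed.

Lemma finite_natP (S : nset) : finite_nat S <-> eventually (fun k => ~ S k).
Proof.
  split; intros [m Hm]; exists m; intros k Hk.
  - intros HS. specialize (Hm k HS). lia.
  - destruct (Nat.lt_ge_cases k m) as [|L]; [assumption | now destruct (Hm k L)].
Qed.

Lemma sub_starP (S S' : nset) : sub_star S S' <-> eventually (fun k => S k -> S' k).
Proof.
  unfold sub_star. rewrite finite_natP.
  split; apply eventually_mono; intros k; [|tauto].
  intros N HS. apply NNPP. tauto.
Qed.

Lemma eq_starP (S S' : nset) : eq_star S S' <-> eventually (fun k => S k <-> S' k).
Proof.
  unfold eq_star. rewrite !sub_starP. split.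
  - intros [H H']. apply eventually_mono with (2 := eventually_and H H'). tauto.
  - intros H. split; apply eventually_mono with (2 := H); tauto.
Qed.

Lemma sub_star_trans (S S' S'' : nset) : sub_star S S' -> sub_star S' S'' -> sub_star S S''.
Proof.
  rewrite !sub_starP. intros H H'.
  apply eventually_mono with (2 := eventually_and H H'). tauto.
Qed.

Definition infinite_nat (S : nset) : Prop := forall m, exists k, m <= k /\ S k.

Lemma infinite_natP (S : nset) : infinite_nat S <-> ~ finite_nat S.
Proof.
  rewrite finite_natP. split.
  - intros H [m Hm]. destruct (H m) as (k & L & HS). now apply (Hm k L).
  - intros H m. apply NNPP. intros N. apply H. exists m. intros k L HS. apply N. eauto.
Qed.

Lemma infinite_nat_sub (S S' : nset) :
  (forall k, S k -> S' k) -> infinite_nat S -> infinite_nat S'.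
Proof. intros H HS m. destruct (HS m) as (k & L & K). eauto. Qed.

Lemma infinite_nat_eventually (S : nset) (P : nat -> Prop) :
  infinite_nat S -> eventually P -> infinite_nat (fun k => S k /\ P k).
Proof.
  intros HS [m Hm] n. destruct (HS (max m n)) as (k & L & K).
  exists k. repeat split; [lia | assumption | apply Hm; lia].
Qed.

Lemma AD_family_range (I : Type) (A : I -> nset) :
  (forall x, infinite_nat (A x)) ->
  (forall x y, x <> y -> finite_nat (inter (A x) (A y))) ->
  AD_family (fun S => exists x, S = A x).
Proof.
  intros inf disj. split.
  - intros S [x ->]. now apply infinite_natP.
  - intros S S' [x ->] [y ->] N. apply disj. congruence.
Qed.

Lemma almost_disjoint_inj (I : Type) (A : I -> nset) :
  (forall x, infinite_nat (A x)) ->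
  (forall x y, x <> y -> finite_nat (inter (A x) (A y))) ->
  forall x y, A x = A y -> x = y.
Proof.
  intros inf disj x y E. apply NNPP. intros N.
  apply (proj1 (infinite_natP (A x)) (inf x)).
  destruct (disj x y N) as [m Hm]. exists m. intros k K. apply Hm. split; congruence.
Qed.

(** * Countability *)

Definition countable_pred (T : Type) (P : T -> Prop) : Prop :=
  exists f : T -> nat, forall a b, P a -> P b -> f a = f b -> a = b.

Lemma countable_sigP (T : Type) (P : T -> Prop) : countable {t | P t} <-> countable_pred P.
Proof.
  split; intros [f Hf].
  - exists (fun t => match excluded_middle_informative (P t) with
                     | left Ht => f (exist _ t Ht) | right _ => 0 end).
    intros a b Pa Pb. destruct (excluded_middle_informative (P a)); [|contradiction].
    destruct (excluded_middle_informative (P b)); [|contradiction].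
    intros E%Hf. exact (f_equal (@proj1_sig _ _) E).
  - exists (fun t => f (proj1_sig t)). intros [a Ha] [b Hb] E. cbn in E.
    destruct (Hf a b Ha Hb E). f_equal. apply proof_irrelevance.
Qed.

Lemma countable_pred_sub (T : Type) (P Q : T -> Prop) :
  (forall t, P t -> Q t) -> countable_pred Q -> countable_pred P.
Proof. intros H [f Hf]. exists f. auto. Qed.

Lemma countable_pred_add (T : Type) (P : T -> Prop) (a : T) :
  countable_pred P -> countable_pred (fun t => P t \/ t = a).
Proof.
  intros [f Hf].
  exists (fun t => if excluded_middle_informative (t = a) then 0 else S (f t)).
  intros b c Hb Hc. destruct (excluded_middle_informative (b = a)),
    (excluded_middle_informative (c = a)); try discriminate; [congruence|].
  intros [= E]. apply Hf; tauto.
Qed.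

Lemma countable_pred_In (T : Type) (l : list T) : countable_pred (fun t => In t l).
Proof.
  induction l as [|a l IH]; [now exists (fun _ => 0)|].
  apply countable_pred_sub with (2 := countable_pred_add a IH). cbn. intuition.
Qed.

Lemma countable_pred_list (T : Type) (P : T -> Prop) :
  countable_pred P -> countable_pred (Forall P).
Proof.
  intros [f Hf]. exists (fold_right (fun t n => S (Cantor.to_nat (f t, n))) 0).
  induction a as [|t l IH]; intros [|t' l']; cbn [fold_right]; try discriminate; [auto|].
  rewrite !Forall_cons_iff. intros [Ht Hl] [Ht' Hl'] E%eq_add_S%Cantor.to_nat_inj.
  injection E as E E'. f_equal; auto.
Qed.

Lemma countable_pred_image (A B : Type) (f : A -> B) (P : A -> Prop) :
  countable_pred P -> countable_pred (fun b => exists a, P a /\ f a = b).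
Proof.
  intros [g Hg].
  destruct (choice (fun b n => (exists a, P a /\ f a = b) ->
                               exists a, P a /\ f a = b /\ n = g a)) as [s Hs].
  { intros b. destruct (classic (exists a, P a /\ f a = b)) as [(a & Ha & E)|N];
      [exists (g a); eauto | now exists 0]. }
  exists s. intros b b' Hb Hb' E.
  destruct (Hs b Hb) as (a & Ha & <- & Ea), (Hs b' Hb') as (a' & Ha' & <- & Ea').
  f_equal. apply Hg; congruence.
Qed.

Lemma countable_pred_bigcup (I T : Type) (J : I -> Prop) (P : I -> T -> Prop) :
  countable_pred J -> (forall i, J i -> countable_pred (P i)) ->
  countable_pred (fun t => exists i, J i /\ P i t).
Proof.
  intros [c Hc] HP.
  destruct (choice (fun i (g : T -> nat) =>
                      J i -> forall a b, P i a -> P i b -> g a = g b -> a = b)) as [f Hf].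
  { intros i. destruct (classic (J i)) as [Hi|Hi]; [|now exists (fun _ => 0)].
    destruct (HP i Hi) as [g Hg]. eauto. }
  destruct (choice (fun t n => (exists i, J i /\ P i t) ->
                               exists i, J i /\ P i t /\ n = Cantor.to_nat (c i, f i t)))
    as [s Hs].
  { intros t. destruct (classic (exists i, J i /\ P i t)) as [(i & Hi & Ht)|N];
      [exists (Cantor.to_nat (c i, f i t)); eauto | now exists 0]. }
  exists s. intros a b Ha Hb E.
  destruct (Hs a Ha) as (i & Hi & Pa & Ea), (Hs b Hb) as (j & Hj & Pb & Eb).
  rewrite Ea, Eb in E. apply Cantor.to_nat_inj in E. injection E as E E'.
  assert (i = j) as <- by now apply Hc. now apply (Hf i Hi).
Qed.

Lemma uncountable_piece (T : Type) (P : nat -> T -> Prop) (Q : T -> Prop) :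
  (forall t, Q t -> exists n, P n t) ->
  ~ countable_pred Q -> exists n, ~ countable_pred (P n).
Proof.
  intros H HQ. apply NNPP. intros N. apply HQ.
  apply countable_pred_sub with (Q := fun t => exists n, True /\ P n t).
  - intros t Ht. destruct (H t Ht). eauto.
  - apply countable_pred_bigcup; [now exists id|].
    intros n _. apply NNPP. eauto.
Qed.

Lemma countable_pred_enumeration (T : Type) (P : T -> Prop) :
  countable_pred P -> (exists t, P t) ->
  exists e : nat -> T, forall t, P t <-> exists n, e n = t.
Proof.
  intros [f Hf] [t0 Ht0].
  destruct (choice (fun n t => P t /\ forall t', P t' -> f t' = n -> t = t')) as [e He].
  { intros n. destruct (classic (exists t, P t /\ f t = n)) as [(t & Ht & <-)|N].
    - exists t. split; [assumption|]. intros t' Ht' E. now apply Hf.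
    - exists t0. split; [assumption|]. intros t' Ht' E. destruct N. eauto. }
  exists e. intros t. split.
  - intros Ht. exists (f t). now apply He.
  - intros [n <-]. apply He.
Qed.

(** * Amalgamation of partial functions *)

Lemma increasing_transversal (E : nat -> nset) :
  (forall p, infinite_nat (E p)) ->
  exists z : nat -> nat, (forall p, E p (z p)) /\ (forall p, z p < z (S p)).
Proof.
  intros H.
  destruct (choice (fun (q : nat * nat) k => snd q <= k /\ E (fst q) k)) as [next Hnext].
  { intros [p m]. apply H. }
  set (z := fix z p := match p with
                       | 0 => next (0, 0)
                       | S p' => next (p, S (z p')) end).
  exists z. split.
  - destruct p; apply (Hnext (_, _)).
  - intros p. apply (Hnext (_, _)).
Qed.

Lemma increasing_lt (z : nat -> nat) :
  (forall p, z p < z (S p)) -> forall p q, p < q -> z p < z q.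
Proof. intros H p q. induction 1; [auto|]. etransitivity; eauto. Qed.

Lemma increasing_ge_id (z : nat -> nat) : (forall p, z p < z (S p)) -> forall p, p <= z p.
Proof. intros H. induction p as [|p IH]; [lia|]. specialize (H p). lia. Qed.

Lemma split_pseudo_intersection (D H : nat -> nset) :
  (forall i n, infinite_nat (fun k => D i k /\ forall j, j <= n -> H j k)) ->
  exists Z : bool -> nset,
    (forall k, Z true k -> Z false k -> False) /\
    (forall b n, sub_star (Z b) (H n)) /\
    (forall b i, infinite_nat (fun k => D i k /\ Z b k)).
Proof.
  intros DH.
  destruct (increasing_transversal (fun p => DH (fst (Cantor.of_nat p)) p))
    as (z & Ez & z_incr).
  pose proof (increasing_lt z_incr) as z_lt.
  exists (fun b k => exists p, Nat.even (snd (Cantor.of_nat p)) = b /\ z p = k).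
  split; [|split].
  - intros k (p & Ep & <-) (q & Eq & E).
    destruct (Nat.lt_trichotomy p q) as [L|[->|L]];
      [apply z_lt in L; lia | congruence | apply z_lt in L; lia].
  - intros b n. apply sub_starP. exists (z n). intros k L (p & _ & <-). apply Ez.
    destruct (Nat.lt_ge_cases p n) as [L'|]; [apply z_lt in L'; lia | assumption].
  - intros b i m. set (p := Cantor.to_nat (i, 2 * m + Nat.b2n (negb b))). exists (z p).
    assert (Cantor.of_nat p = (i, 2 * m + Nat.b2n (negb b))) as Ep
      by apply Cantor.cancel_of_to.
    split; [|split].
    + pose proof (Cantor.to_nat_non_decreasing i (2 * m + Nat.b2n (negb b))) as L.
      pose proof (increasing_ge_id z_incr p). fold p in L. lia.
    + specialize (Ez p). rewrite Ep in Ez. apply Ez.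
    + exists p. rewrite Ep. cbn [snd]. split; [|reflexivity].
      rewrite Nat.even_add, Nat.even_mul. now destruct b.
Qed.

Lemma diagonal_index (P : nat -> nat -> Prop) :
  (forall n, eventually (P n)) ->
  exists r : nat -> nat,
    (forall n, eventually (fun k => n <= r k)) /\ eventually (fun k => P (r k) k).
Proof.
  intros HP.
  destruct (choice (fun n m => forall k, m <= k -> P n k) HP) as [M HM].
  destruct (choice (fun k r => (M 0 <= k -> M r <= k) /\
                               forall n, n <= k -> M n <= k -> n <= r)) as [r Hr].
  { intros k. induction k as [|b IH] at 3.
    - exists 0. split; [auto | lia].
    - destruct (Nat.le_gt_cases (M (S b)) k) as [L|L]; [exists (S b); auto|].
      destruct IH as (r & Hr & Hmax). exists r. split; [assumption|].
      intros n Hn Ln. destruct (Nat.eq_dec n (S b)) as [->|]; [lia | apply Hmax; lia]. }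
  exists r. split.
  - intros n. exists (max n (M n)). intros k L. apply Hr; lia.
  - exists (M 0). intros k L. apply HM, Hr, L.
Qed.

Definition agree_on (W : Type) (B : W -> Prop) (u v : option W) : Prop :=
  forall x, B x -> (u = Some x <-> v = Some x).

Section Amalgamation.
Variables (W : Type) (B : nat -> W -> Prop) (G : nat -> nat -> option W).
Hypothesis G_range : forall n k x, G n k = Some x -> B n x.
Hypothesis G_coherent :
  forall i n, i <= n -> eventually (fun k => agree_on (B i) (G i k) (G n k)).

Lemma coherent_undefined i n :
  i <= n -> eventually (fun k => G n k = None -> G i k = None).
Proof.
  intros L. apply eventually_mono with (2 := G_coherent L). intros k K N.
  destruct (G i k) as [x|] eqn:E; [|reflexivity].
  rewrite N in K. discriminate (proj1 (K x (G_range E)) eq_refl).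
Qed.

Lemma coherent_diagonal :
  exists r : nat -> nat, forall i, eventually (fun k => agree_on (B i) (G i k) (G (r k) k)).
Proof.
  destruct (@diagonal_index (fun n k => forall i, i <= n -> agree_on (B i) (G i k) (G n k)))
    as (r & r_large & Hr).
  { intros n. apply eventually_forall_le. auto. }
  exists r. intros i. apply eventually_mono with (2 := eventually_and (r_large i) Hr).
  intros k [L K]. auto.
Qed.

Variables (D : nat -> nset) (a : W).
Hypothesis D_uncovered : forall i n, infinite_nat (fun k => D i k /\ G n k = None).
Hypothesis a_new : forall n, ~ B n a.

Lemma split_undefined :
  exists Z : bool -> nset,
    (forall k, Z true k -> Z false k -> False) /\
    (forall b i, eventually (fun k => Z b k -> G i k = None)) /\
    (forall b i, infinite_nat (fun k => D i k /\ Z b k)).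
Proof.
  destruct (@split_pseudo_intersection D (fun n k => G n k = None))
    as (Z & Z_disj & Z_undef & Z_inf).
  { intros i n. pose proof (eventually_forall_le (fun j => @coherent_undefined j n)) as HN.
    apply infinite_nat_sub with (2 := infinite_nat_eventually (D_uncovered i n) HN).
    intros k [[HD N] HN']. auto. }
  exists Z. split; [assumption|]. split; [|assumption].
  intros b i. apply sub_starP, Z_undef.
Qed.

(* The diagonal of the [G n] is coherent with all of them but may be defined everywhere.
   It stays coherent when redefined on a set almost disjoint from every domain: half of
   that set gets the new value, the other half is left undefined. *)
Lemma amalgam :
  exists g : nat -> option W,
    (forall k x, g k = Some x -> x = a \/ exists n, B n x) /\
    (forall i, eventually (fun k => agree_on (B i) (G i k) (g k))) /\
    (forall i, infinite_nat (fun k => D i k /\ g k = Some a)) /\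
    (forall i, infinite_nat (fun k => D i k /\ g k = None)).
Proof.
  destruct coherent_diagonal as [r Hr].
  destruct split_undefined as (Z & Z_disj & Z_undef & Z_inf).
  destruct (choice (fun k v => (Z true k -> v = Some a) /\ (Z false k -> v = None) /\
                               (~ Z true k -> ~ Z false k -> v = G (r k) k))) as [g Hg].
  { intros k. specialize (Z_disj k).
    destruct (classic (Z true k)); [exists (Some a); tauto|].
    destruct (classic (Z false k)); [exists None | exists (G (r k) k)]; tauto. }
  exists g. split; [|split; [|split]].
  - intros k x Hx. destruct (Hg k) as (gt & gf & gr).
    destruct (classic (Z true k)) as [H|H]; [left; rewrite gt in Hx; congruence|].
    destruct (classic (Z false k)) as [H'|H']; [rewrite gf in Hx; congruence|].
    right. exists (r k). apply G_range with k. now rewrite <- gr.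
  - intros i. pose proof (eventually_and (Z_undef true i) (Z_undef false i)) as HZ.
    apply eventually_mono with (2 := eventually_and (Hr i) HZ).
    intros k (K & Kt & Kf) x Hx. destruct (Hg k) as (gt & gf & gr).
    destruct (classic (Z true k)) as [H|H].
    { rewrite gt, Kt by assumption. split; [discriminate|].
      intros [= <-]. now apply a_new in Hx. }
    destruct (classic (Z false k)) as [H'|H']; [now rewrite gf, Kf | rewrite gr; auto].
  - intros i. apply infinite_nat_sub with (2 := Z_inf true i).
    intros k [HD HZ]. split; [assumption | now apply Hg].
  - intros i. apply infinite_nat_sub with (2 := Z_inf false i).
    intros k [HD HZ]. split; [assumption | now apply Hg].
Qed.

End Amalgamation.

(** * Representations read off from labels *)

Section LabelledRepresentation.
Variables (X : Type) (le : X -> X -> Prop) (A T : X -> nset).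
Hypothesis le_refl : forall x, le x x.
Hypothesis le_antisym : forall x y, le x y -> le y x -> x = y.
Hypothesis le_trans : forall x y z, le x y -> le y z -> le x z.
Hypothesis A_infinite : forall x, infinite_nat (A x).
Hypothesis A_sub_T : forall x k, A x k -> T x k.

Definition label_decides (k : nat) (v : option X) (x : X) : Prop :=
  (A x k <-> v = Some x) /\ (T x k <-> exists y, le y x /\ v = Some y).

(* The label of [k] may depend on the finite set [l]. *)
Hypothesis labelled :
  forall l : list X, eventually (fun k => exists v, Forall (label_decides k v) l).

Lemma labelled_disjoint x y : x <> y -> finite_nat (inter (A x) (A y)).
Proof.
  intros N. apply finite_natP. apply eventually_mono with (2 := labelled (x :: y :: nil)).
  intros k [v Hv] [Kx Ky]. rewrite !Forall_cons_iff in Hv. destruct Hv as ([Ax _] & [Ay _] & _).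
  apply Ax in Kx. apply Ay in Ky. congruence.
Qed.

Lemma labelled_not_le x y : ~ le y x -> sub_star (A y) (diff (T y) (T x)).
Proof.
  intros N. apply sub_starP. apply eventually_mono with (2 := labelled (x :: y :: nil)).
  intros k [v Hv] Ky. rewrite !Forall_cons_iff in Hv. destruct Hv as ([_ Tx] & [Ay _] & _).
  split; [now apply A_sub_T|]. intros (z & Hz & Ez)%Tx. apply Ay in Ky.
  apply N. congruence.
Qed.

Lemma labelled_inf x y z : is_inf le x y z -> eq_star (inter (T x) (T y)) (T z).
Proof.
  intros (zx & zy & z_inf). apply eq_starP.
  apply eventually_mono with (2 := labelled (x :: y :: z :: nil)).
  intros k [v Hv]. rewrite !Forall_cons_iff in Hv.
  destruct Hv as ([_ Tx] & [_ Ty] & [_ Tz] & _). unfold inter. rewrite Tx, Ty, Tz. split.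
  - intros [(u & ux & ->) (u' & uy & [= <-])]. exists u. auto.
  - intros (u & uz & ->). split; exists u; eauto.
Qed.

Lemma labelled_incompatible x y :
  incompatible le x y -> eq_star (inter (T x) (T y)) (fun _ => False).
Proof.
  intros N. apply eq_starP. apply eventually_mono with (2 := labelled (x :: y :: nil)).
  intros k [v Hv]. rewrite !Forall_cons_iff in Hv. destruct Hv as ([_ Tx] & [_ Ty] & _).
  unfold inter. rewrite Tx, Ty. split; [|contradiction].
  intros [(u & ux & ->) (u' & uy & [= <-])]. apply N. eauto.
Qed.

Lemma labelled_successor_like x :
  successor_like le x ->
  eq_star (fun k => T x k /\ ~ exists z, in_pred le z x /\ T z k) (A x).
Proof.
  intros [[l Hl] x_succ]. apply eq_starP.
  apply eventually_mono with (2 := labelled (x :: l)).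
  intros k [v Hv]. rewrite Forall_cons_iff, Forall_forall in Hv.
  destruct Hv as [[Ax Tx] Tl].
  assert (T_pred : forall z, in_pred le z x -> (T z k <-> exists y, le y z /\ v = Some y))
    by (intros z Hz; now apply Tl, Hl).
  split.
  - intros [(u & ux & Eu)%Tx not_below]. destruct (classic (u = x)) as [->|N]; [now apply Ax|].
    destruct not_below. destruct (x_succ u) as (z & Hz & uz); [now split|].
    exists z. split; [assumption|]. apply T_pred; eauto.
  - intros Kx. split; [now apply A_sub_T|]. intros (z & Hz & Kz).
    apply (T_pred z Hz) in Kz. destruct Kz as (u & uz & Eu). apply Ax in Kx.
    replace u with x in uz by congruence.
    destruct Hz as [[zx N] _]. apply N. now apply le_antisym.
Qed.

Lemma labelled_representation : AD_representation le T A.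
Proof.
  split; [exact (almost_disjoint_inj A_infinite labelled_disjoint)|].
  split; [exact (AD_family_range A_infinite labelled_disjoint)|].
  split; [exact A_sub_T|].
  split; [exact labelled_not_le|].
  split; [exact labelled_inf|].
  split; [exact labelled_successor_like | exact labelled_incompatible].
Qed.

End LabelledRepresentation.

(** * Inseparability from large intersections *)

Lemma omega_inseparable_range (I : Type) (A : I -> nset) :
  AD_family (fun S => exists x, S = A x) ->
  (forall (n : nat) (c : nat -> nset),
     (forall i, i < n -> ~ countable_pred (fun x => sub_star (A x) (c i))) ->
     infinite_nat (fun k => forall i, i < n -> c i k)) ->
  omega_inseparable (fun S => exists x, S = A x).
Proof.
  intros [_ A_disj] A_inter n Hn L LA L_unc L_disj. split.
  - intros i j Hi Hj N S S' HS HS'. apply A_disj; eauto.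
    intros <-. eauto.
  - intros (c & c_sep & c_fin). revert c_fin. apply infinite_natP, A_inter.
    intros i Hi Hc. apply (L_unc i Hi), countable_sigP.
    apply countable_pred_sub with (2 := countable_pred_image A Hc).
    intros S HS. destruct (LA i Hi S HS) as [x ->].
    exists x. split; [now apply (c_sep i Hi) | reflexivity].
Qed.

(** * The first uncountable ordinal *)

Lemma wf_choice (W G : Type) (R : W -> W -> Prop) (g0 : G) (step : W -> (W -> G) -> G -> Prop) :
  well_founded R ->
  (forall a h h' g, (forall b, R b a -> h b = h' b) -> step a h g -> step a h' g) ->
  (forall a h, (forall b, R b a -> step b h (h b)) -> exists g, step a h g) ->
  exists h, forall a, step a h (h a).
Proof.
  intros wf step_local step_exists.
  set (extend := fun a (rec : forall b, R b a -> G) b =>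
                   match excluded_middle_informative (R b a) with
                   | left Hb => rec b Hb | right _ => g0 end).
  set (F := fun a rec => epsilon (inhabits g0) (step a (extend a rec))).
  set (h := Fix wf (fun _ => G) F).
  assert (h_eq : forall a, h a = F a (fun b _ => h b)).
  { intros a. unfold h. apply (Fix_eq wf (fun _ => G) F). intros x f f' Hf.
    replace f' with f; [reflexivity|].
    extensionality b. extensionality Hb. apply Hf. }
  assert (h_extend : forall a b, R b a -> h b = extend a (fun b _ => h b) b).
  { intros a b Hb. unfold extend. now destruct (excluded_middle_informative (R b a)). }
  exists h. induction a as [a IH] using (well_founded_ind wf).
  apply step_local with (h := extend a (fun b _ => h b)); [intros; symmetry; auto|].
  rewrite (h_eq a). unfold F. apply epsilon_spec.
  destruct (step_exists a h IH) as [g Hg]. exists g. apply step_local with (h := h); auto.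
Qed.

Section Omega1.
Variables (W : Type) (ltW : W -> W -> Prop).
Hypothesis W_omega1 : is_omega1 ltW.

Definition leW (a b : W) : Prop := ltW a b \/ a = b.

Lemma ltW_wf : well_founded ltW.
Proof. apply W_omega1. Qed.

Lemma ltW_irrefl a : ~ ltW a a.
Proof. induction a as [a IH] using (well_founded_ind ltW_wf). intros H. now apply (IH a). Qed.

Lemma ltW_trans a b c : ltW a b -> ltW b c -> ltW a c.
Proof. apply W_omega1. Qed.

Lemma leW_refl a : leW a a.
Proof. now right. Qed.

Lemma leW_ltW_trans a b c : leW a b -> ltW b c -> ltW a c.
Proof. intros [H| ->]; [now apply ltW_trans | auto]. Qed.

Lemma ltW_leW_trans a b c : ltW a b -> leW b c -> ltW a c.
Proof. intros H [H'| <-]; [now apply ltW_trans with b | assumption]. Qed.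

Lemma leW_trans a b c : leW a b -> leW b c -> leW a c.
Proof. intros [H| ->] H'; [left; now apply ltW_leW_trans with b | assumption]. Qed.

Lemma leW_or_gt a b : leW a b \/ ltW b a.
Proof. destruct W_omega1 as (_ & _ & total & _). unfold leW. destruct (total a b); tauto. Qed.

Lemma leW_not_gt a b : leW a b -> ~ ltW b a.
Proof. intros H H'. apply (@ltW_irrefl a). now apply leW_ltW_trans with b. Qed.

Lemma leW_max a b : exists c, (c = a \/ c = b) /\ leW a c /\ leW b c.
Proof.
  destruct (leW_or_gt a b) as [H|H]; [exists b | exists a]; unfold leW in *; tauto.
Qed.

Lemma countable_ltW a : countable_pred (fun b => ltW b a).
Proof. apply countable_sigP, W_omega1. Qed.

Lemma countable_leW a : countable_pred (fun b => leW b a).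
Proof. apply countable_pred_add, countable_ltW. Qed.

Lemma uncountable_cofinal (S : W -> Prop) b :
  ~ countable_pred S -> exists x, S x /\ ltW b x.
Proof.
  intros H. apply NNPP. intros N. apply H.
  apply countable_pred_sub with (2 := countable_leW b). intros x Hx.
  destruct (leW_or_gt x b) as [|L]; [assumption|]. destruct N. eauto.
Qed.

Lemma countable_bounded (I : Type) (J : I -> Prop) (w : I -> W) :
  countable_pred J -> exists b, forall i, J i -> ltW (w i) b.
Proof.
  intros HJ. apply NNPP. intros N.
  destruct W_omega1 as (_ & _ & _ & W_unc & _). apply W_unc.
  destruct (countable_pred_bigcup HJ (P := fun i t => leW t (w i))) as [f Hf].
  - intros i _. apply countable_leW.
  - assert (cover : forall t, exists i, J i /\ leW t (w i)).
    { intros t. apply NNPP. intros N'. apply N. exists t. intros i Hi.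
      destruct (leW_or_gt t (w i)) as [L|]; [|assumption]. destruct N'. eauto. }
    exists f. intros a b. now apply Hf.
Qed.

Lemma list_bounded (I : Type) (w : I -> W) (l : list I) :
  exists b, Forall (fun i => ltW (w i) b) l.
Proof.
  destruct (countable_bounded w (countable_pred_In l)) as [b Hb].
  exists b. now apply Forall_forall.
Qed.

Lemma running_max (e : nat -> W) :
  exists c : nat -> W,
    (forall n, leW (e n) (c n)) /\ (forall i n, i <= n -> leW (c i) (c n)) /\
    (forall n, exists i, c n = e i).
Proof.
  destruct (choice _ (fun p => leW_max (fst p) (snd p))) as [mx Hmx].
  set (c := fix c n := match n with 0 => e 0 | S n' => mx (c n', e n) end).
  exists c. split; [|split].
  - intros [|n]; [apply leW_refl | apply (Hmx (_, _))].
  - intros i n. induction 1 as [|n _ IH]; [apply leW_refl|].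
    apply leW_trans with (c n); [assumption | apply (Hmx (c n, e (S n)))].
  - induction n as [|n [i IH]]; [now exists 0|]. cbn [c]. fold c.
    destruct (Hmx (c n, e (S n))) as [[E|E] _]; rewrite E; [now exists i | now exists (S n)].
Qed.

Lemma cofinal_chain a :
  (exists b, ltW b a) ->
  exists c : nat -> W,
    (forall n, ltW (c n) a) /\ (forall i n, i <= n -> leW (c i) (c n)) /\
    (forall b, ltW b a -> exists n, leW b (c n)).
Proof.
  intros Ha. destruct (countable_pred_enumeration (countable_ltW a) Ha) as [e He].
  destruct (running_max e) as (c & c_ge & c_mono & c_val).
  exists c. split; [|split; [assumption|]].
  - intros n. destruct (c_val n) as [i ->]. apply He. eauto.
  - intros b [n <-]%He. eauto.
Qed.

Lemma club_gt b : club ltW (fun d => ltW b d).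
Proof.
  split.
  - intros a. destruct (list_bounded id (a :: b :: nil)) as [c Hc].
    rewrite !Forall_cons_iff in Hc. exists c. tauto.
  - intros d [[a Ha] _] Hd. destruct (Hd a Ha) as (c & Lc & _ & Ld).
    now apply ltW_trans with c.
Qed.

(** * Coherent sequences of partial functions *)

Implicit Type h : W -> nat -> option W.

Definition coherent_extension a h (g : nat -> option W) : Prop :=
  (forall k x, g k = Some x -> leW x a) /\
  (forall b, ltW b a -> eventually (fun k => agree_on (fun x => leW x b) (h b k) (g k))).

Definition coherent h : Prop := forall a, coherent_extension a h (h a).

Definition fiber h (x : W) : nset := fun k => h x k = Some x.

Lemma coherent_extension_le a b h :
  coherent_extension b h (h b) -> leW a b ->
  eventually (fun k => agree_on (fun x => leW x a) (h a k) (h b k)).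
Proof. intros [_ H] [L| ->]; [auto | now apply eventually_all]. Qed.

Lemma fiber_eventually a b h :
  coherent h -> leW a b -> eventually (fun k => fiber h a k <-> h b k = Some a).
Proof.
  intros Hh L. apply eventually_mono with (2 := coherent_extension_le (Hh b) L).
  intros k K. apply K, leW_refl.
Qed.

Lemma fiber_disjoint h :
  coherent h -> forall a b, a <> b -> finite_nat (inter (fiber h a) (fiber h b)).
Proof.
  intros Hh a b N. destruct (leW_max a b) as (c & _ & La & Lb). apply finite_natP.
  apply eventually_mono with
    (2 := eventually_and (fiber_eventually Hh La) (fiber_eventually Hh Lb)).
  unfold inter. intros k [-> ->] []. congruence.
Qed.

(* The first clause follows from the second unless [a] is minimal. *)
Definition uncovered a h (D : nset) : Prop :=
  infinite_nat D /\ forall b, ltW b a -> infinite_nat (fun k => D k /\ h b k = None).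

Definition splits a (g : nat -> option W) (D : nset) : Prop :=
  infinite_nat (fun k => D k /\ g k = Some a) /\ infinite_nat (fun k => D k /\ g k = None).

Lemma coherent_splitting_minimal a h (D : nat -> nset) :
  ~ (exists b, ltW b a) -> (forall i, infinite_nat (D i)) ->
  exists g, coherent_extension a h g /\ forall i, splits a g (D i).
Proof.
  intros a_min D_inf.
  destruct (@amalgam W (fun _ _ => False) (fun _ _ => None)) with (D := D) (a := a)
    as (g & g_range & _ & g_new & g_undef).
  - discriminate.
  - intros i n _. now apply eventually_all.
  - intros i _. apply infinite_nat_sub with (2 := D_inf i). auto.
  - auto.
  - exists g. split; [split|now split].
    + intros k x Hx. destruct (g_range k x Hx) as [->|[_ []]]. apply leW_refl.
    + intros b Hb. destruct a_min. eauto.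
Qed.

Lemma coherent_splitting_nonminimal a h (D : nat -> nset) :
  (exists b, ltW b a) ->
  (forall b, ltW b a -> coherent_extension b h (h b)) ->
  (forall i, uncovered a h (D i)) ->
  exists g, coherent_extension a h g /\ forall i, splits a g (D i).
Proof.
  intros Ha h_coh D_unc. destruct (cofinal_chain Ha) as (c & c_lt & c_mono & c_cof).
  destruct (@amalgam W (fun n x => leW x (c n)) (fun n => h (c n))) with (D := D) (a := a)
    as (g & g_range & g_coh & g_new & g_undef).
  - intros n. now apply h_coh.
  - intros i n L. apply coherent_extension_le; auto.
  - intros i n. now apply D_unc.
  - intros n L. now apply (leW_not_gt L).
  - exists g. split; [split|now split].
    + intros k x Hx. destruct (g_range k x Hx) as [->|[n Hn]]; [apply leW_refl|].
      left. now apply leW_ltW_trans with (c n).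
    + intros b Hb. destruct (c_cof b Hb) as [n Hn].
      pose proof (coherent_extension_le (h_coh _ (c_lt n)) Hn) as b_coh.
      apply eventually_mono with (2 := eventually_and b_coh (g_coh n)).
      intros k [K K'] x Hx. rewrite (K x Hx). apply K'. now apply leW_trans with b.
Qed.

Lemma coherent_splitting a h (D : nat -> nset) :
  (forall b, ltW b a -> coherent_extension b h (h b)) ->
  (forall i, uncovered a h (D i)) ->
  exists g, coherent_extension a h g /\ forall i, splits a g (D i).
Proof.
  intros h_coh D_unc. destruct (classic (exists b, ltW b a)).
  - now apply coherent_splitting_nonminimal.
  - apply coherent_splitting_minimal; [assumption|]. intros i. apply D_unc.
Qed.

(** * The recursion *)

Section Construction.
Variable U : (W -> nset) -> W -> nset.

Definition request h (l : list W) : nset := fun k => Forall (fun d => U (fiber h) d k) l.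

Definition pending a h (l : list W) : Prop :=
  Forall (fun d => leW d a) l /\ uncovered a h (request h l).

Definition splitting_extension a h (g : nat -> option W) : Prop :=
  coherent_extension a h g /\ forall l, pending a h l -> splits a g (request h l).

Lemma pending_nil a h :
  (forall b, ltW b a -> splitting_extension b h (h b)) -> pending a h nil.
Proof.
  induction a as [a IH] using (well_founded_ind ltW_wf). intros Hh.
  split; [constructor|]. split.
  - intros m. exists m. split; [auto | constructor].
  - intros b Hb. apply (Hh b Hb), IH; [assumption|].
    intros c Hc. apply Hh. now apply ltW_trans with b.
Qed.

Lemma splitting_extension_exists a h :
  (forall b, ltW b a -> splitting_extension b h (h b)) ->
  exists g, splitting_extension a h g.
Proof.
  intros Hh.
  assert (countable_pred (pending a h)) as cnt.
  { apply countable_pred_sub with (2 := countable_pred_list (countable_leW a)).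
    now intros l []. }
  destruct (countable_pred_enumeration cnt (ex_intro _ nil (pending_nil Hh))) as [E HE].
  destruct (@coherent_splitting a h (fun n => request h (E n))) as (g & g_coh & g_splits).
  - intros b Hb. now apply Hh.
  - intros n. apply HE. eauto.
  - exists g. split; [assumption|]. intros l [n <-]%HE. apply g_splits.
Qed.

Definition local : Prop :=
  forall A A' d, (forall x, ltW x d -> A x = A' x) -> U A d = U A' d.

Hypothesis U_local : local.

Lemma request_local a h h' l :
  (forall b, ltW b a -> h b = h' b) -> Forall (fun d => leW d a) l ->
  request h l = request h' l.
Proof.
  intros E Hl. rewrite Forall_forall in Hl.
  assert (HU : forall d, In d l -> U (fiber h) d = U (fiber h') d).
  { intros d Hd. apply U_local. intros x Hx. unfold fiber.
    rewrite E; [reflexivity|]. apply ltW_leW_trans with d; auto. }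
  extensionality k. apply propositional_extensionality. unfold request.
  rewrite !Forall_forall. split; intros K d Hd; [rewrite <- HU | rewrite HU]; auto.
Qed.

Lemma splitting_extension_local a h h' g :
  (forall b, ltW b a -> h b = h' b) -> splitting_extension a h g -> splitting_extension a h' g.
Proof.
  intros E [[g_range g_coh] g_splits]. split; [split; [assumption|]|].
  - intros b Hb. rewrite <- E by assumption. auto.
  - intros l (Hl & D_inf & D_unc). rewrite <- (request_local E Hl) in *.
    apply g_splits. split; [assumption|]. split; [assumption|].
    intros b Hb. rewrite E by assumption. auto.
Qed.

Lemma splitting_sequence_exists : exists h, forall a, splitting_extension a h (h a).
Proof.
  apply (wf_choice (fun _ => None) ltW_wf);
    [apply splitting_extension_local | apply splitting_extension_exists].
Qed.

End Construction.

(** * Inseparability *)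

Definition guessing (U : (W -> nset) -> W -> nset) : Prop :=
  forall (A : W -> nset) (c : nset) (b : W),
  ~ countable_pred (fun x => sub_star (A x) c) ->
  exists d b', leW d b' /\ ltW b b' /\ sub_star (U A d) c /\
    forall e, ltW e b' -> exists x, ltW e x /\ sub_star (A x) (U A d).

Section Inseparability.
Variables (U : (W -> nset) -> W -> nset) (h : W -> nat -> option W).
Hypothesis h_splitting : forall a, splitting_extension U a h (h a).

Lemma splitting_coherent : coherent h.
Proof. intros a. apply h_splitting. Qed.

Lemma pending_le l a b : pending U a h l -> leW a b -> pending U b h l.
Proof.
  intros (Hl & D_inf & D_unc).
  induction b as [b IH] using (well_founded_ind ltW_wf). intros L. split; [|split].
  - apply Forall_impl with (2 := Hl). intros d Hd. now apply leW_trans with a.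
  - assumption.
  - intros c Hc. destruct (leW_or_gt a c) as [L'|L']; [|auto].
    now apply (h_splitting c), IH.
Qed.

Lemma fiber_infinite a : infinite_nat (fiber h a).
Proof.
  assert (splits a (h a) (request U h nil)) as [H _].
  { apply h_splitting, pending_nil. auto. }
  apply infinite_nat_sub with (2 := H). tauto.
Qed.

Lemma fiber_AD : AD_family (fun S => exists x, S = fiber h x).
Proof. exact (AD_family_range fiber_infinite (fiber_disjoint splitting_coherent)). Qed.

Lemma fiber_inj a b : fiber h a = fiber h b -> a = b.
Proof. now apply (almost_disjoint_inj fiber_infinite (fiber_disjoint splitting_coherent)). Qed.

(* For [x > e], the fiber at [x] is almost disjoint from the domain of [h e]. *)
Lemma pending_cons l b b' d :
  pending U b h l -> ltW b b' -> leW d b' ->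
  (forall e, ltW e b' -> exists x, ltW e x /\ sub_star (fiber h x) (U (fiber h) d)) ->
  pending U b' h (d :: l).
Proof.
  intros Hl Lb Ld Hx.
  assert (D_unc : forall e, ltW e b' ->
            infinite_nat (fun k => request U h (d :: l) k /\ h e k = None)).
  { intros e He. destruct (leW_max b e) as (e' & Ee' & Lbe & Lee).
    destruct (Hx e') as (x & Lx & HxU%sub_starP); [now destruct Ee'; subst|].
    destruct (splitting_coherent e) as [e_range _].
    assert (ltW e x) as Lex by now apply leW_ltW_trans with e'.
    pose proof (coherent_extension_le (splitting_coherent x) (or_introl Lex)) as x_coh.
    assert (pending U x h l) as Hlx.
    { apply pending_le with b; [assumption|]. left. now apply leW_ltW_trans with e'. }
    destruct (proj2 (h_splitting x) l Hlx) as [D_new _].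
    apply infinite_nat_sub with
      (2 := infinite_nat_eventually D_new (eventually_and HxU x_coh)).
    intros k [[K Kx] [KU Kagree]]. split; [constructor; auto|].
    destruct (h e k) as [y|] eqn:Ky; [|reflexivity].
    pose proof (e_range _ _ Ky) as Ly.
    pose proof (proj1 (Kagree y Ly) eq_refl) as Kxy.
    assert (y = x) as -> by congruence.
    destruct (leW_not_gt Ly Lex). }
  split; [|split; [|assumption]].
  - constructor; [assumption|]. apply (pending_le Hl). now left.
  - apply infinite_nat_sub with (2 := D_unc b Lb). tauto.
Qed.

Hypothesis U_guessing : guessing U.

Lemma pending_below_intersection (n : nat) (c : nat -> nset) :
  (forall i, i < n -> ~ countable_pred (fun x => sub_star (fiber h x) (c i))) ->
  exists b l, pending U b h l /\ sub_star (request U h l) (fun k => forall i, i < n -> c i k).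
Proof.
  induction n as [|n IH]; intros c_unc.
  - destruct (list_bounded id (@nil W)) as [b _]. exists b, nil.
    split; [apply pending_nil; auto|]. apply sub_starP, eventually_all. lia.
  - destruct IH as (b & l & Hl & Hlc%sub_starP); [auto|].
    destruct (U_guessing b (c_unc n (le_n _))) as (d & b' & Ld & Lb & Hdc%sub_starP & Hx).
    exists b', (d :: l). split; [now apply pending_cons with b|].
    apply sub_starP. apply eventually_mono with (2 := eventually_and Hlc Hdc).
    intros k [Kl Kd] [Ud Ul]%Forall_cons_iff i Hi.
    destruct (Nat.eq_dec i n) as [->|]; [auto | apply Kl; [assumption | lia]].
Qed.

Lemma fiber_omega_inseparable : omega_inseparable (fun S => exists x, S = fiber h x).
Proof.
  apply (omega_inseparable_range fiber_AD). intros n c c_unc.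
  destruct (pending_below_intersection c_unc) as (b & l & (_ & l_inf & _) & Hlc%sub_starP).
  apply infinite_nat_sub with (2 := infinite_nat_eventually l_inf Hlc). tauto.
Qed.

End Inseparability.

(** * Coding *)

Section Coding.
Variables (h : W -> nat -> option W) (X : Type) (leX : X -> X -> Prop).
Variables (f : W -> X) (w : X -> W) (bd : X -> W).
Hypothesis h_coherent : coherent h.
Hypothesis f_inj : forall a b, f a = f b -> a = b.
Hypothesis wK : forall x, f (w x) = x.
Hypothesis leX_refl : forall x, leX x x.
Hypothesis bdP : forall x y, leX y x -> leW (w y) (bd x).

(* The first disjunct makes [A_x] a subset of [T_x], not just modulo finite. *)
Definition coding_set (x : X) : nset :=
  fun k => fiber h (w x) k \/ exists y, leX y x /\ h (bd x) k = Some (w y).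

Lemma option_map_Some_iff (u : option W) x : option_map f u = Some x <-> u = Some (w x).
Proof.
  destruct u as [a|]; cbn; [|easy]. split.
  - intros [= <-]. f_equal. apply f_inj. now rewrite wK.
  - intros [= ->]. now rewrite wK.
Qed.

Lemma coding_set_label b x : leW (bd x) b ->
  eventually (fun k => label_decides leX (fun x => fiber h (w x)) coding_set
                         k (option_map f (h b k)) x).
Proof.
  intros L. assert (leW (w x) b) as Lx by (apply leW_trans with (bd x); auto).
  pose proof (fiber_eventually h_coherent Lx) as Hx.
  pose proof (coherent_extension_le (h_coherent b) L) as Hbd.
  apply eventually_mono with (2 := eventually_and Hx Hbd). intros k [Kx Kbd].
  split; [now rewrite option_map_Some_iff|]. split.
  - intros [K|(y & Hy & K)].
    + exists x. rewrite option_map_Some_iff, <- Kx. auto.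
    + exists y. split; [assumption|]. apply option_map_Some_iff.
      now apply (Kbd (w y) (bdP Hy)).
  - intros (y & Hy & K%option_map_Some_iff). right. exists y. split; [assumption|].
    now apply (Kbd (w y) (bdP Hy)).
Qed.

Lemma coding_set_labelled (l : list X) :
  eventually (fun k => exists v,
    Forall (label_decides leX (fun x => fiber h (w x)) coding_set k v) l).
Proof.
  destruct (list_bounded bd l) as [b Hb].
  apply eventually_mono with
    (P := fun k => Forall (label_decides leX (fun x => fiber h (w x)) coding_set k
                             (option_map f (h b k))) l); [eauto|].
  apply eventually_Forall, Forall_impl with (2 := Hb).
  intros x Hx. apply coding_set_label. now left.
Qed.

End Coding.

Lemma fibers_code h (X : Type) (leX : X -> X -> Prop) :
  coherent h -> (forall a, infinite_nat (fiber h a)) -> omega1_like leX W ->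
  codes leX (fun S => exists a, S = fiber h a).
Proof.
  intros Hh h_inf (refl & antisym & trans & _ & [f [f_inj f_surj]] & below_cnt).
  destruct (choice (fun x a => f a = x) f_surj) as [w wK].
  assert (exists bd : X -> W, forall x y, leX y x -> leW (w y) (bd x)) as [bd bdP].
  { apply choice with (R := fun x b => forall y, leX y x -> leW (w y) b). intros x.
    pose proof (countable_pred_add x (proj1 (countable_sigP _) (below_cnt x))) as cnt.
    destruct (countable_bounded w cnt) as [b Hb]. exists b. intros y Hy. left. apply Hb.
    destruct (classic (y = x)); [now right | left; now split]. }
  assert (AD_representation leX (coding_set h leX w bd) (fun x => fiber h (w x))) as R.
  { apply labelled_representation; auto.
    - now left.
    - now apply coding_set_labelled with (f := f). }
  exists (fun x => fiber h (w x)). split; [|split; [apply R | eexists; exact R]].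
  intros S. split; [|intros [x ->]; eauto].
  intros [a ->]. exists (f a). f_equal. apply f_inj. now rewrite wK.
Qed.

(** * Guessing principles *)

Lemma CH_guessing : CH W -> exists U, local U /\ guessing U.
Proof.
  intros [f [_ f_surj]]. exists (fun _ d k => f d k = true). split; [easy|].
  intros A c b c_unc.
  destruct (f_surj (fun k => if excluded_middle_informative (c k) then true else false))
    as [d Hd].
  assert (forall k, f d k = true <-> c k) as fd.
  { intros k. rewrite Hd. now destruct (excluded_middle_informative (c k)). }
  destruct (list_bounded id (d :: b :: nil)) as [b' Hb'].
  rewrite !Forall_cons_iff in Hb'. destruct Hb' as (Ld & Lb & _).
  exists d, b'. split; [now left|]. split; [assumption|]. split.
  - apply sub_starP, eventually_all. intros k. apply fd.
  - intros e _. destruct (uncountable_cofinal e c_unc) as (x & Hx & Lx).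
    exists x. split; [assumption|]. apply sub_star_trans with (1 := Hx).
    apply sub_starP, eventually_all. intros k. apply fd.
Qed.

Lemma clubsuit_guessing : clubsuit ltW -> exists U, local U /\ guessing U.
Proof.
  intros (C & C_ladder & C_guess).
  exists (fun A d k => exists x, (C d x /\ ltW x d) /\ A x k). split.
  { intros A A' d E. extensionality k. f_equal. extensionality x.
    apply propositional_extensionality.
    split; intros [[Hx L] K]; [rewrite <- E | rewrite E]; auto. }
  intros A c b c_unc.
  destruct (uncountable_piece (P := fun m x => forall k, m <= k -> A x k -> c k)
              (fun x => proj1 (sub_starP (A x) c)) c_unc) as [m m_unc].
  rewrite <- countable_sigP in m_unc.
  destruct (C_guess _ m_unc _ (club_gt b)) as (d & [d_lim C_sub] & Ld).
  destruct (C_ladder d d_lim) as (_ & C_lt & C_cof).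
  exists d, d. split; [apply leW_refl|]. split; [assumption|]. split.
  - apply sub_starP. exists m. intros k L (x & [Hx _] & K). now apply (C_sub x Hx k L).
  - intros e He. destruct (C_cof e He) as (x & Hx & L). exists x. split; [assumption|].
    apply sub_starP, eventually_all. eauto 6.
Qed.

End Omega1.

Theorem mainTheorem4 :
  forall (W : Type) (ltW : W -> W -> Prop),
    is_omega1 ltW ->
    (CH W \/ clubsuit ltW) ->
    exists F : family,
      AD_family F /\
      card_omega1 W {S : nset | F S} /\
      omega_inseparable F /\
      (forall (X : Type) (le : X -> X -> Prop),
          omega1_like le W -> codes le F).
Proof.
  intros W ltW HW Hguess.
  assert (exists U, local ltW U /\ guessing ltW U) as (U & U_local & U_guess).
  { destruct Hguess; [now apply CH_guessing | now apply clubsuit_guessing]. }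
  destruct (splitting_sequence_exists HW U_local) as [h Hh].
  exists (fun S => exists x, S = fiber h x). split; [|split; [|split]].
  - exact (fiber_AD HW Hh).
  - exists (fun x => exist _ (fiber h x) (ex_intro _ x eq_refl)). split.
    + intros a b E. exact (fiber_inj HW Hh (f_equal (@proj1_sig _ _) E)).
    + intros [S [x ->]]. now exists x.
  - exact (fiber_omega_inseparable HW Hh U_guess).
  - intros X le. exact (fibers_code HW (splitting_coherent Hh) (fiber_infinite HW Hh)).
Qed.
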